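(* Let $n,d\ge1$ be integers, let $p$ be a prime, let $x^{\mathbf a_1},\dots,x^{\mathbf a_l}$ be the distinct monomials of degree $d$ in the variables $x_1,\dots,x_n$, and let $\Bbbk=\mathbb F_p(\alpha_1,\dots,\alpha_l)$, where $\alpha_1,\dots,\alpha_l$ are algebraically independent over $\mathbb F_p$. Consider the polynomial $f=\alpha_1x^{\mathbf a_1}+\cdots+\alpha_lx^{\mathbf a_l}\in\Bbbk[x_1,\dots,x_n]$, and let $\mathfrak m=\langle x_1,\dots,x_n\rangle\subset\Bbbk[x_1,\dots,x_n]$. If $p>d$, then the test ideal $\tau(f^t)$ is equal to $(\mathfrak m^d)^{[t]}$ for every real $0<t<1$.
   Context: Let $R=\Bbbk[x_1,\dots,x_n]$ with $\Bbbk$ a field of characteristic $p$ with $[\Bbbk:\Bbbk^p]<\infty$, and let $\mathfrak a$ be a nonzero proper ideal of $R$. Frobenius powers. For an ideal $\mathfrak b$ of $R$ and $e\ge0$, $\mathfrak b^{[p^e]}=\langle f^{p^e}: f\in\mathfrak b\rangle$, and $\mathfrak b^{[1/p^e]}$ is the smallest ideal $\mathfrak c$ with $\mathfrak b\subseteq\mathfrak c^{[p^e]}$. If $m\in\mathbb N$ has base $p$ expansion $m=m_0+m_1p+\cdots+m_rp^r$, then $\mathfrak a^{[m]}=\mathfrak a^{m_0}(\mathfrak a^{m_1})^{[p]}\cdots(\mathfrak a^{m_r})^{[p^r]}$. For $t=m/p^e$ with $m\in\mathbb N$, $\mathfrak a^{[t]}=(\mathfrak a^{[m]})^{[1/p^e]}$.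 For a real number $t\ge0$, $\mathfrak a^{[t]}=\bigcup_k\mathfrak a^{[t_k]}$, where $(t_k)$ is any sequence of rational numbers whose denominators are powers of $p$ converging to $t$ monotonically from above (the union equals $\mathfrak a^{[t_k]}$ for $k\gg0$). Test ideals. For real $t\ge0$, $\tau(\mathfrak a^t)=(\mathfrak a^{\lceil tp^e\rceil})^{[1/p^e]}$ for all $e\gg0$ (an increasing, eventually constant, chain in $e$); $\tau(f^t)$ means $\tau(\langle f\rangle^t)$. *)

(* Defs.v *)
From HB Require Import structures.
From mathcomp Require Import all_boot all_order all_algebra.
(* mpoly must be imported before the analysis files, otherwise the levels of
   their notations clash. *)
From mathcomp Require Import mpoly.
From mathcomp Require Import boolp classical_sets reals.
From mathcomp Require Import topology normedtype sequences.

Set Implicit Arguments.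
Unset Strict Implicit.
Unset Printing Implicit Defensive.

Import Order.TTheory GRing.Theory Num.Theory.
Import numFieldNormedType.Exports.

Local Open Scope classical_set_scope.
Local Open Scope ring_scope.

Section Ideals.
Variable A : comNzRingType.
Implicit Types (I J : set A).

(* Not necessarily proper, unlike the library's idealr_closed. *)
Definition is_ideal I : Prop :=
  [/\ I 0,
      forall x y, I x -> I y -> I (x + y) &
      forall a x, I x -> I (a * x)].

Definition ideal_gen (S : set A) : set A := smallest is_ideal S.

Definition ideal_mul I J : set A :=
  ideal_gen [set z | exists x y, [/\ I x, J y & z = x * y]].

Definition ideal_exp I (m : nat) : set A := iter m (ideal_mul I) setT.

(* I^[q], used with q = p ^ e. *)
Definition frob I (q : nat) : set A :=
  ideal_gen [set x ^+ q | x in I].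

(* I^[1/q]: whenever there is a smallest ideal J with I `<=` J^[q], it is this
   intersection; the family is never empty, as it contains the unit ideal. *)
Definition frob_root I (q : nat) : set A :=
  \bigcap_(J in [set J | is_ideal J /\ I `<=` frob J q]) J.

Section Powers.
Variable p : nat.

Definition digit (m i : nat) : nat := ((m %/ p ^ i) %% p)%N.

(* I^[m] for a natural number m.  The digits of m are those of index at most
   trunc_log p m; for m = 0 this gives I ^ 0 = setT. *)
Definition frob_pow_nat I (m : nat) : set A :=
  \big[ideal_mul/setT]_(i < (trunc_log p m).+1)
     frob (ideal_exp I (digit m i)) (p ^ i).

(* I^[m/p^e] *)
Definition frob_pow_rat I (m e : nat) : set A :=
  frob_root (frob_pow_nat I m) (p ^ e).

(* J is I^[t]: J is the union of the I^[t_k] for every sequence of p-adic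
   fractions t_k = m k / p ^ e k converging to t monotonically from above.
   For p > 1 and t >= 0 such sequences exist, so J is unique. *)
Definition is_frob_pow (R : realType) I (t : R) J : Prop :=
  forall m e : nat -> nat,
    let u : R^nat := fun k => (m k)%:R / p%:R ^+ e k in
    nonincreasing_seq u -> u @ \oo --> t ->
    J = \bigcup_k frob_pow_rat I (m k) (e k).

(* J is tau(I^t), for t >= 0; absz only converts the ceiling to nat. *)
Definition is_test_ideal (R : realType) I (t : R) J : Prop :=
  \forall e \near \oo,
    frob_root (ideal_exp I `|Num.ceil (t * p%:R ^+ e)|%N) (p ^ e) = J.

End Powers.
End Ideals.

Section Field.
Variables (k K : fieldType) (iota : {rmorphism k -> K}).
Variables (l : nat) (alpha : 'I_l -> K).

Definition alg_independent : Prop :=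
  forall P : {mpoly k[l]}, mmap iota alpha P = 0 -> P = 0.

(* K = k(alpha_1, .., alpha_l) *)
Definition field_generated : Prop :=
  forall c : K, exists P Q : {mpoly k[l]},
    mmap iota alpha Q != 0 /\ c = mmap iota alpha P / mmap iota alpha Q.

End Field.

Definition max_ideal (K : fieldType) (n : nat) : set {mpoly K[n]} :=
  ideal_gen (range (fun i : 'I_n => 'X_i : {mpoly K[n]})).

(* Main.v *)
Require Import Defs.
From HB Require Import structures.
From mathcomp Require Import all_boot all_order all_algebra.
From mathcomp Require Import mpoly.
From mathcomp Require Import boolp classical_sets reals.
From mathcomp Require Import topology normedtype sequences.
From mathcomp Require Import finfield ring.

Set Implicit Arguments.
Unset Strict Implicit.
Unset Printing Implicit Defensive.

Import Order.TTheory GRing.Theory Num.Theory.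
Import numFieldNormedType.Exports.

Local Open Scope classical_set_scope.
Local Open Scope ring_scope.

(** Write f^m as the image of (Y_1 + .. + Y_l)^m under Y_i |-> alpha_i x^(a_i).
    For m < p^e the monomials alpha^b with b in the support of the latter are
    distinct members of a basis of K over K^(p^e), so (f^m)^[1/p^e] is generated
    by the monomials x^floor(g / p^e), where g ranges over the exponents b.a.
    A product of multinomial coefficients with top entries < p is nonzero mod p;
    hence these g are exactly the sums of the u_i p^i with |u_i| = d m_i, m_i
    the base p digits of m, i.e. the exponents generating (M^d)^[m], M the
    maximal ideal.  Therefore (f^m)^[1/p^e] = (M^d)^[m/p^e], and the passage to
    real t only uses that the right-hand side is monotone and right constant in
    m/p^e and, for m <= p^e, generated in degrees at most d. *)

(** * Generators of products and Frobenius powers *)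

Section IdealLemmas.
Variable A : comNzRingType.
Implicit Types (I J S T : set A).

Lemma is_ideal_gen S : is_ideal (ideal_gen S).
Proof.
split=> [J [[]] //|x y Sx Sy J hJ|a x Sx J hJ].
  by case: (hJ) => -[_ JD _] _; apply: JD; [apply: Sx|apply: Sy].
by case: (hJ) => -[_ _ JM] _; apply: JM; apply: Sx.
Qed.

Lemma ideal_gen_sub S J : is_ideal J -> S `<=` J -> ideal_gen S `<=` J.
Proof. exact: smallest_sub. Qed.

Lemma sub_ideal_gen S : S `<=` ideal_gen S.
Proof. exact: sub_gen_smallest. Qed.

Lemma ideal_gen_mono S T : S `<=` ideal_gen T -> ideal_gen S `<=` ideal_gen T.
Proof. by apply: ideal_gen_sub; apply: is_ideal_gen. Qed.

Lemma ideal_genM S x y : ideal_gen S y -> ideal_gen S (x * y).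
Proof. by case: (is_ideal_gen S) => _ _; apply. Qed.

(** Membership of a product in an ideal is linear in each factor separately, so it is checked on
    generators one factor at a time. *)
Lemma ideal_mul_gen S T :
  ideal_mul (ideal_gen S) (ideal_gen T) =
  ideal_gen [set x * y | x in S & y in T].
Proof.
apply/seteqP; split; apply: ideal_gen_mono; last first.
  move=> _ [x Sx [y Ty <-]]; apply: sub_ideal_gen; exists x, y.
  by split=> //; apply: sub_ideal_gen.
move=> _ [x [y [Sx Ty ->]]]; set U := ideal_gen _.
have [U0 UD UM] : is_ideal U := is_ideal_gen _.
have SU : ideal_gen S `<=` [set u | forall v, ideal_gen T v -> U (u * v)].
  apply: ideal_gen_sub.
    split=> [v _|u u' Hu Hu' v Tv|a u Hu v Tv]; first by rewrite mul0r.
      by rewrite mulrDl; apply: UD; [apply: Hu|apply: Hu'].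
    by rewrite -mulrA; apply: UM; apply: Hu.
  move=> u Su; apply: ideal_gen_sub.
    split=> [|v v' Hv Hv'|a v Hv]; first by rewrite mulr0.
      by rewrite mulrDr; apply: UD.
    by rewrite mulrCA; apply: UM.
  by move=> v Tv; apply: sub_ideal_gen; exists u => //; exists v.
exact: SU.
Qed.

(** In characteristic [p] the map [x ^+ (p ^ e)] is additive, so the elements whose power lies in a
    given ideal form an ideal, and generators suffice. *)
Lemma frob_gen (p e : nat) S : p \in [pchar A] ->
  frob (ideal_gen S) (p ^ e) = ideal_gen [set x ^+ (p ^ e) | x in S].
Proof.
move=> pA; apply/seteqP; split; apply: ideal_gen_mono; last first.
  move=> _ [x Sx <-]; apply: sub_ideal_gen; exists x => //.
  exact: sub_ideal_gen.
move=> _ [z Sz <-]; set U := ideal_gen _.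
have [U0 UD UM] : is_ideal U := is_ideal_gen _.
have p_gt0 : (0 < p ^ e)%N by rewrite expn_gt0 prime_gt0 // (pcharf_prime pA).
have pp : [pchar A].-nat (p ^ e)%N.
  by rewrite pnatX pnatE ?(pcharf_prime pA) // pA.
suff SU : ideal_gen S `<=` [set x | U (x ^+ (p ^ e))] by exact: SU.
apply: ideal_gen_sub => [|x Sx].
  split=> [|x y Ux Uy|a x Ux] /=; first by rewrite expr0n gtn_eqF.
    by rewrite exprDn_pchar //; apply: UD.
  by rewrite exprMn; apply: UM.
by apply: sub_ideal_gen; exists x.
Qed.

(** The scheme for computing every root below: the first hypothesis puts the ideal of [T] into the
    family that is intersected, the second bounds that family from below. *)
Lemma frob_root_gen (q : nat) S T : S `<=` frob (ideal_gen T) q ->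
  (forall J, is_ideal J -> S `<=` frob J q -> T `<=` J) ->
  frob_root (ideal_gen S) q = ideal_gen T.
Proof.
move=> ST TJ; apply/seteqP; split.
  move=> x; apply; split; first exact: is_ideal_gen.
  by apply: ideal_gen_sub => //; apply: is_ideal_gen.
move=> x Tx J [Jid SJ]; move: x Tx; apply: ideal_gen_sub => //.
by apply: TJ => // x Sx; apply: SJ; apply: sub_ideal_gen.
Qed.

Lemma ideal_gen_setT : ideal_gen [set 1] = [set: A].
Proof.
apply/seteqP; split=> // x _; rewrite -[x]mulr1.
by apply: ideal_genM; apply: sub_ideal_gen.
Qed.

Lemma ideal_exp_principal (f : A) m :
  ideal_exp (ideal_gen [set f]) m = ideal_gen [set f ^+ m].
Proof.
elim: m => [|m IHm]; first by rewrite expr0 ideal_gen_setT.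
rewrite /ideal_exp iterS -/(ideal_exp _ _) IHm ideal_mul_gen.
congr ideal_gen; apply/seteqP; split=> [_ [_ -> [_ -> <-]] /=|_ ->].
  by rewrite exprS.
by exists f => //; exists (f ^+ m) => //; rewrite exprS.
Qed.

End IdealLemmas.

(** * Root-linear maps *)

Section RootLinear.

(* The algebraic form of reading off (the q-th root of) a coordinate with
   respect to a basis of A over A^q. *)
Definition root_linear (A : comNzRingType) (q : nat) (phi : A -> A) : Prop :=
  (forall x y, phi (x + y) = phi x + phi y) /\
  (forall a b, phi (a ^+ q * b) = a * phi b).

Variables (A : comNzRingType) (q : nat) (phi : A -> A).
Hypothesis phiL : root_linear q phi.

Lemma root_linear0 : phi 0 = 0.
Proof.
by case: phiL => phiD _; apply: (addrI (phi 0)); rewrite -phiD !addr0.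
Qed.

(** If [g] is a sum of terms [b * x ^+ q] with [x] in [J], then [phi g] is the sum of the
    [x * phi b]. This gives the lower bounds for Frobenius roots. *)
Lemma root_linear_frob (J : set A) : is_ideal J ->
  frob J q `<=` [set g | J (phi g)].
Proof.
move=> Jid; have [J0 JD JM] := Jid; have [phiD phiM] := phiL.
(* The extra factor [b] makes the right-hand set an ideal, although [phi] is not linear over [A]. *)
have key : frob J q `<=` [set g | forall b, J (phi (b * g))].
  apply: ideal_gen_sub.
    split=> [b|x y Hx Hy b|a x Hx b]; first by rewrite mulr0 root_linear0.
      by rewrite mulrDr phiD; apply: JD.
    by rewrite mulrA; apply: Hx.
  by move=> _ [x Jx <-] b; rewrite mulrC phiM mulrC; apply: JM.
by move=> g /key /(_ 1); rewrite mul1r.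
Qed.

End RootLinear.

Section RootLinearPoly.
Variables (n : nat) (k : comNzRingType) (q : nat).
Implicit Types (g : {mpoly k[n]}) (m delta : 'X_{1..n}).

(** The coordinate along ['X_[delta]] in the monomial basis over [q]-th powers, with [phi] taking
    roots of the coefficients. The bound [msize g] only makes the sum finite. *)
Definition mroot (phi : k -> k) delta g : {mpoly k[n]} :=
  \sum_(m : 'X_{1..n < msize g}) phi g@_(m *+ q + delta)%MM *: 'X_[m].

Lemma mcoeffMX_lem g m m' :
  (g * 'X_[m])@_m' = if (m <= m')%MM then g@_(m' - m)%MM else 0.
Proof.
case: ifP => [le_mm'|nle]; first by rewrite -{1}(submK le_mm') addmC mcoeffMX.
apply: memN_msupp_eq0; apply: contraFN nle.
by rewrite (perm_mem (msuppMX _ _)) => /mapP[m'' _ ->]; apply: lem_addr.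
Qed.

Lemma mcoeff_mroot phi delta g m : (0 < q)%N -> phi 0 = 0 ->
  (mroot phi delta g)@_m = phi g@_(m *+ q + delta)%MM.
Proof.
move=> q_gt0 phi0; rewrite /mroot.
have [lt_mg|le_gm] := ltnP (mdeg m) (msize g).
  by rewrite (mcoeff_mpoly (fun m => phi g@_(m *+ q + delta)%MM) lt_mg).
rewrite raddf_sum /= big1 => [|m' _]; last first.
  rewrite mcoeffZ mcoeffX; case: eqP => [m'E|]; last by rewrite mulr0.
  by move: (bmdeg m'); rewrite m'E ltnNge le_gm.
rewrite memN_msupp_eq0 ?phi0 //; apply: msize_mdeg_ge.
rewrite mdegD mdegMn (leq_trans le_gm) // (leq_trans (leq_pmulr _ q_gt0)) //.
exact: leq_addr.
Qed.

(** Since [q] is a power of [p], both sides are additive in [a], which may then be a single term [c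
    *: 'X_[m]]; multiplying by its [q]-th power shifts the exponents by [m *+ q]. *)
Lemma root_linear_mroot p phi delta : p \in [pchar k] -> p.-nat q ->
  (forall i, delta i < q)%N ->
  root_linear q phi -> root_linear q (mroot phi delta).
Proof.
move=> pk pq ltdq phiL; have [phiD phiM] := phiL.
have q_gt0 : (0 < q)%N by case/andP: pq.
have phi0 := root_linear0 phiL.
have rootD x y :
    mroot phi delta (x + y) = mroot phi delta x + mroot phi delta y.
  by apply/mpolyP=> m; rewrite mcoeffD !mcoeff_mroot // mcoeffD phiD.
split=> // a b; elim/mpolyind: a => [|c m a _ _ IHa].
  by rewrite expr0n gtn_eqF //= !mul0r; apply/mpolyP=> m;
     rewrite mcoeff_mroot // !mcoeff0.
have pq' : [pchar {mpoly k[n]}].-nat q.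
  have pkn : p \in [pchar {mpoly k[n]}].
    exact: (rmorph_pchar (GRing.RMorphism.clone _ _ (@mpolyC n k) _)).
  by apply: sub_in_pnat pq => r _ /eqnP ->.
rewrite exprDn_pchar // mulrDl rootD IHa mulrDl; congr (_ + _).
apply/mpolyP=> m'; rewrite mcoeff_mroot // exprZn -!scalerAl !mcoeffZ.
rewrite phiM; congr (_ * _).
rewrite mpolyXn [_ * b]mulrC [_ * mroot _ _ b]mulrC.
rewrite !mcoeffMX_lem mcoeff_mroot //.
(* Here [delta i < q] matters: the remainder is too small to raise a quotient. *)
have -> : (m *+ q <= m' *+ q + delta)%MM = (m <= m')%MM.
  apply/mnm_lepP/mnm_lepP => le i; have := le i.
    rewrite mnmDE !mulmnE => lei; rewrite -ltnS -(ltn_pmul2r q_gt0) mulSn addnC.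
    by apply: leq_ltn_trans lei _; rewrite ltn_add2l.
  rewrite mnmDE !mulmnE => lei.
  by rewrite (leq_trans _ (leq_addr _ _)) // leq_mul2r lei orbT.
case: ifP => // /mnm_lepP le; congr (phi b@_ _); apply/mnmP => i.
by rewrite !(mnmDE, mnmBE, mulmnE) mulnBl addnBAC // leq_mul2r le orbT.
Qed.

End RootLinearPoly.

(** A root-linear map extends to fractions by writing [P / Q] as [P * Q ^+ q.-1] over [Q ^+ q],
    whose denominator has the root [Q]. *)
Lemma root_linear_frac (A : comNzRingType) (K : fieldType)
    (ev : {rmorphism A -> K}) (q : nat) (phi : A -> A) :
  (0 < q)%N -> injective ev ->
  (forall c : K, exists P Q, ev Q != 0 /\ c = ev P / ev Q) ->
  root_linear q phi ->
  exists psi : K -> K,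
    root_linear q psi /\ forall P, psi (ev P) = ev (phi P).
Proof.
move=> q_gt0 evI evF [phiD phiM].
have {evF} /choice[num /choice[den nd]] := evF.
have den0 c : ev (den c) != 0 by case: (nd c).
have numE c : c = ev (num c) / ev (den c) by case: (nd c).
have expr_pred x : x ^+ q = x * x ^+ q.-1 :> A by rewrite -exprS prednK.
pose psi c := ev (phi (num c * den c ^+ q.-1)) / ev (den c).
(* The value does not depend on the chosen fraction: after cross-multiplying, the outer denominators
   enter [phi] as [q]-th powers. *)
have psiE P Q : ev Q != 0 ->
    psi (ev P / ev Q) = ev (phi (P * Q ^+ q.-1)) / ev Q.
  move=> Q0; rewrite /psi; set c := ev P / ev Q.
  have eqPQ : num c * Q = P * den c.
    apply: evI; rewrite !rmorphM; apply/eqP; rewrite -eqr_div //.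
    by rewrite -(numE c).
  apply/eqP; rewrite eqr_div //; apply/eqP; rewrite -!rmorphM; congr (ev _).
  rewrite ![phi _ * _]mulrC -!phiM; congr phi.
  rewrite (expr_pred Q) (expr_pred (den c)).
  transitivity (num c * Q * (Q ^+ q.-1 * den c ^+ q.-1)); first by ring.
  by rewrite eqPQ; ring.
exists psi; split; last first.
  move=> P; have := psiE P 1; rewrite rmorph1 oner_eq0 !divr1 expr1n mulr1.
  exact.
split=> x y; rewrite [x]numE [y]numE.
  move: (num x) (den x) (den0 x) (num y) (den y) (den0 y) => P Q Q0 P' Q' Q0'.
  have QQ0 : ev (Q * Q') != 0 by rewrite rmorphM mulf_neq0.
  have -> : ev P / ev Q = ev (P * Q') / ev (Q * Q').
    by rewrite !rmorphM; field; rewrite Q0 Q0'.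
  have -> : ev P' / ev Q' = ev (P' * Q) / ev (Q * Q').
    by rewrite !rmorphM; field; rewrite Q0 Q0'.
  by rewrite -mulrDl -rmorphD !psiE // mulrDl phiD rmorphD mulrDl.
move: (num x) (den x) (den0 x) (num y) (den y) (den0 y) => P Q Q0 P' Q' Q0'.
have QQ0 : ev (Q ^+ q * Q') != 0.
  by rewrite rmorphM rmorphXn mulf_neq0 ?expf_neq0.
have -> : (ev P / ev Q) ^+ q * (ev P' / ev Q') =
    ev (P ^+ q * P') / ev (Q ^+ q * Q').
  by rewrite expr_div_n !rmorphM !rmorphXn; field; rewrite Q0' expf_neq0.
rewrite !psiE //.
have -> : P ^+ q * P' * (Q ^+ q * Q') ^+ q.-1 =
    (P * Q ^+ q.-1) ^+ q * (P' * Q' ^+ q.-1).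
  by rewrite !exprMn -!exprM mulnC; ring.
rewrite phiM (expr_pred Q) !rmorphM !rmorphXn.
by field; rewrite Q0 Q0' expf_neq0.
Qed.

(** * Exponents of Frobenius powers *)

Section Exponents.
Variables (n d p : nat).
Implicit Types (u v g : 'X_{1..n}) (m : nat).

Lemma lem_mdeg_split (m : 'X_{1..n}) k : (k <= mdeg m)%N ->
  exists2 v, (v <= m)%MM & mdeg v = k.
Proof.
elim: k => [|k IHk] ltkm.
  by exists 0%MM; [apply/mnm_lepP => i; rewrite mnm0E|rewrite mdeg0].
have [v /mnm_lepP le_vm vk] := IHk (ltnW ltkm).
have /existsP[i lt_vmi] : [exists i, (v i < m i)%N].
  apply: contraLR ltkm; rewrite negb_exists -leqNgt -vk !mdegE => /forallP ge.
  by apply: leq_sum => i _; rewrite leqNgt.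
exists (v + U_(i))%MM; last by rewrite mdegD mdeg1 vk addn1.
apply/mnm_lepP => j; rewrite mnmDE mnm1E.
by case: eqP => [<-|_]; rewrite ?addn1 ?addn0.
Qed.

(* The exponents of the monomials generating (M^d)^[m], M the maximal ideal. *)
Inductive frob_expo : nat -> 'X_{1..n} -> Prop :=
| FrobExpo0 : frob_expo 0 0%MM
| FrobExpoS m r u g : (r < p)%N -> mdeg u = (d * r)%N -> frob_expo m g ->
    frob_expo (m * p + r) (u + g *+ p)%MM.

(** Splits off the last digit; the base case counts as digit [0] over quotient [0]. *)
Lemma frob_expo_inv m g : (0 < p)%N -> frob_expo m g ->
  exists u g', [/\ mdeg u = (d * (m %% p))%N, frob_expo (m %/ p) g' &
                   g = (u + g' *+ p)%MM].
Proof.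
move=> p_gt0; case=> [|{g}m r u g ltrp degu mg].
  exists 0%MM, 0%MM; split; first by rewrite mod0n muln0 mdeg0.
    by rewrite div0n; apply: FrobExpo0.
  by apply/mnmP => i; rewrite mnmDE mulmnE !mnm0E.
exists u, g; split=> //; first by rewrite modnMDl modn_small.
by rewrite divnMDl // divn_small // addn0.
Qed.

Lemma mdeg_frob_expo m g : frob_expo m g -> mdeg g = (d * m)%N.
Proof.
elim=> [|{g}m' r u g _ du _ dg]; first by rewrite mdeg0 muln0.
by rewrite mdegD mdegMn du dg mulnDr mulnA addnC.
Qed.

Lemma frob_expo_mulp m g : frob_expo m g -> (0 < p)%N ->
  frob_expo (m * p) (g *+ p)%MM.
Proof.
move=> mg p_gt0; rewrite -[X in frob_expo X]addn0 -[X in frob_expo _ X]add0m.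
by apply: FrobExpoS; rewrite // mdeg0 muln0.
Qed.

(** Subtraction of [1] in base [p]. A nonzero last digit gives up a piece [v] of [u] of degree [d];
    a zero digit borrows [v *+ p] from the higher digits and keeps [v *+ p.-1] of it. *)
Lemma frob_expo_pred m g : (0 < p)%N -> frob_expo m.+1 g ->
  exists g' v, [/\ frob_expo m g', mdeg v = d & (v + g' <= g)%MM].
Proof.
move=> p_gt0; move mE : m.+1 => M Mg.
elim: Mg m mE => // {g} m' [|r] u g ltrp degu mg IHg m.
  move: degu; rewrite muln0 addn0 => /eqP; rewrite mdeg_eq0 => /eqP ->.
  case: m' mg IHg => // m' mg IHg mE.
  have [g' [v [mg' degv /mnm_lepP le_vg]]] := IHg m' erefl.
  exists (v *+ p.-1 + g' *+ p)%MM, v; split=> //.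
    have -> : m = (m' * p + p.-1)%N.
      by apply: succn_inj; rewrite mE mulSn -addnS prednK // addnC.
    by apply: FrobExpoS; rewrite ?prednK // mdegMn degv.
  apply/mnm_lepP => i; have := le_vg i; rewrite !(mnmDE, mulmnE, mnm0E) add0n.
  by move=> lei; rewrite addnA -mulnS prednK // -mulnDl leq_mul2r lei orbT.
rewrite addnS => -[->].
have [v le_vu degv] : exists2 v, (v <= u)%MM & mdeg v = d.
  by apply: lem_mdeg_split; rewrite degu mulnS leq_addr.
exists (u - v + g *+ p)%MM, v; split=> //; last first.
  by rewrite addmA [(v + _)%MM]addmC submK //; apply/mnm_lepP.
apply: FrobExpoS => //; first exact: ltnW.
apply/eqP; rewrite -(eqn_add2r (mdeg v)) -mdegD submK // degu degv mulnS.
by rewrite addnC.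
Qed.

Lemma frob_expo_mono m m' g : (0 < p)%N -> (m' <= m)%N -> frob_expo m g ->
  exists2 g', frob_expo m' g' & (g' <= g)%MM.
Proof.
move=> p_gt0 /subnK <-; elim: (m - m')%N g => [|k IHk] g mg.
  by exists g => //; apply/mnm_lepP.
have [g1 [v [mg1 _ le_g1]]] := frob_expo_pred p_gt0 mg.
have [g2 mg2 le_g2] := IHk _ mg1; exists g2 => //.
by apply: lepm_trans le_g2 (lepm_trans (lem_addl _ _) le_g1).
Qed.

(* The exponents of the monomials in (M^d)^[m/p^e]. *)
Definition root_expo m e : set 'X_{1..n} :=
  [set u | exists2 g, frob_expo m g & forall i, (g i %/ p ^ e <= u i)%N].

(** The exponents depend only on the fraction [m / p ^ e]: the new last digit is [0], which forces
    its contribution to the exponent to vanish. *)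
Lemma root_expo_shift m e : (0 < p)%N ->
  root_expo (m * p) e.+1 = root_expo m e.
Proof.
move=> p_gt0; apply/seteqP; split=> u [g mg le_gu].
  have [v [g' [degv mg' gE]]] := frob_expo_inv p_gt0 mg.
  move: degv mg'; rewrite modnMl muln0 mulnK // => /eqP.
  rewrite mdeg_eq0 => /eqP v0 mg'; exists g' => // i.
  have := le_gu i; rewrite gE v0 mnmDE mulmnE mnm0E add0n expnS mulnC.
  by rewrite divnMl.
exists (g *+ p)%MM; first exact: frob_expo_mulp.
by move=> i; rewrite mulmnE expnS mulnC divnMl.
Qed.

Lemma root_expo_shiftX m e k : (0 < p)%N ->
  root_expo (m * p ^ k) (e + k) = root_expo m e.
Proof.
move=> p_gt0; elim: k => [|k IHk]; first by rewrite muln1 addn0.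
by rewrite expnSr mulnA addnS root_expo_shift.
Qed.

(** Both fractions are brought to the denominator [p ^ (e + e')], where monotonicity in the
    numerator applies. *)
Lemma root_expo_mono m m' e e' : (0 < p)%N ->
  (m' * p ^ e <= m * p ^ e')%N -> root_expo m e `<=` root_expo m' e'.
Proof.
move=> p_gt0 le_m; rewrite -(root_expo_shiftX m e e') //.
rewrite -(root_expo_shiftX m' e' e) // addnC => u [g mg le_gu].
have [g' mg' /mnm_lepP le_g] := frob_expo_mono p_gt0 le_m mg.
by exists g' => // i; apply: leq_trans (le_gu i); apply: leq_div2r.
Qed.

(* floor(g / p^e) does not change when v / p^(e+1), with |v| = d < p, is added
   to g / p^e. *)
Lemma root_expo_right m e : (0 < n)%N -> (1 < p)%N -> (d < p)%N ->
  root_expo m e `<=` root_expo (m * p + 1) e.+1.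
Proof.
move=> n_gt0 p_gt1 ltdp u [g mg le_gu].
have p_gt0 := ltnW p_gt1.
pose v : 'X_{1..n} := (U_(Ordinal n_gt0) *+ d)%MM.
have degv : mdeg v = d by rewrite mdegMn mdeg1 mul1n.
exists (v + g *+ p)%MM; first by apply: FrobExpoS; rewrite // degv muln1.
move=> i; apply: leq_trans (le_gu i); rewrite mnmDE mulmnE expnS.
have lt_vp : (v i < p)%N.
  by apply: leq_ltn_trans ltdp; rewrite -degv mdegE (bigD1 i) //= leq_addr.
by rewrite divnMA addnC divnMDl // (divn_small lt_vp) addn0.
Qed.

(** With [v] the floor of [g / p ^ e], the degree of [v] is at most [d * m / p ^ e]. Hence finitely
    many exponents decide everything for fractions up to [1]. *)
Lemma root_expo_bounded m e u : (0 < p)%N -> (m <= p ^ e)%N ->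
  root_expo m e u ->
  exists2 v, root_expo m e v & (mdeg v <= d)%N /\ (v <= u)%MM.
Proof.
move=> p_gt0 le_m [g mg le_gu].
exists [multinom (g i %/ p ^ e)%N | i < n].
  by exists g => // i; rewrite mnmE.
split; last by apply/mnm_lepP => i; rewrite mnmE.
have pe_gt0 : (0 < p ^ e)%N by rewrite expn_gt0 p_gt0.
rewrite -(leq_pmul2r pe_gt0) mdegE big_distrl /=.
apply: leq_trans (_ : mdeg g <= _)%N.
  by rewrite mdegE; apply: leq_sum => i _; rewrite mnmE leq_divM.
by rewrite (mdeg_frob_expo mg) leq_mul2l le_m orbT.
Qed.

Lemma root_expo_up m e u v : root_expo m e v -> (v <= u)%MM ->
  root_expo m e u.
Proof.
move=> [g mg le_gv] /mnm_lepP le_vu; exists g => // i.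
exact: leq_trans (le_gv i) (le_vu i).
Qed.

End Exponents.

(** * Monomial ideals and their Frobenius powers *)

Section MonomialIdeals.
Variables (n : nat) (k : comNzRingType).
Implicit Types (S T : set 'X_{1..n}).

Definition mono_ideal S : set {mpoly k[n]} := ideal_gen [set 'X_[m] | m in S].

Lemma mono_ideal_mul S T : ideal_mul (mono_ideal S) (mono_ideal T) =
  mono_ideal [set (s + t)%MM | s in S & t in T].
Proof.
rewrite /mono_ideal ideal_mul_gen; congr ideal_gen; apply/seteqP; split.
  move=> _ [_ [s Ss <-] [_ [t Tt <-] <-]].
  by exists (s + t)%MM; rewrite ?mpolyXD //; exists s => //; exists t.
move=> _ [_ [s Ss [t Tt <-]] <-]; rewrite mpolyXD.
by exists 'X_[s]; [exists s|exists 'X_[t] => //; exists t].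
Qed.

Lemma pchar_mpoly p : p \in [pchar k] -> p \in [pchar {mpoly k[n]}].
Proof.
exact: (rmorph_pchar (GRing.RMorphism.clone _ _ (@mpolyC n k) _)).
Qed.

Lemma frob_mono_ideal p e S : p \in [pchar k] ->
  frob (mono_ideal S) (p ^ e) = mono_ideal [set (s *+ (p ^ e))%MM | s in S].
Proof.
move=> pk; rewrite /mono_ideal (frob_gen _ _ (pchar_mpoly pk)).
congr ideal_gen; apply/seteqP; split.
  move=> _ [_ [s Ss <-] <-]; rewrite mpolyXn.
  by exists (s *+ (p ^ e))%MM => //; exists s.
by move=> _ [_ [s Ss <-] <-]; rewrite -mpolyXn; exists 'X_[s] => //; exists s.
Qed.

Lemma mono_ideal_setT : mono_ideal [set 0%MM] = setT.
Proof. by rewrite -ideal_gen_setT /mono_ideal image_set1 mpolyX0. Qed.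

Lemma mono_ideal_exp d r :
  ideal_exp (mono_ideal [set m | mdeg m = d]) r =
  mono_ideal [set m | mdeg m = (d * r)%N].
Proof.
elim: r => [|r IHr].
  rewrite muln0 -[LHS]/setT -mono_ideal_setT; congr mono_ideal.
  apply/seteqP; split=> m /=; first by move=> ->; rewrite mdeg0.
  by move=> /eqP; rewrite mdeg_eq0 => /eqP.
rewrite /ideal_exp iterS -/(ideal_exp _ _) IHr mono_ideal_mul.
congr mono_ideal; apply/seteqP; split.
  by move=> _ [u /= du [v /= dv <-]]; rewrite mdegD du dv mulnS.
move=> m /= dm; have [v le_vm dv] : exists2 v, (v <= m)%MM & mdeg v = d.
  by apply: lem_mdeg_split; rewrite dm mulnS leq_addr.
exists v => //; exists (m - v)%MM; last by rewrite addmC submK.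
by move: dm; rewrite -{1}(submK le_vm) mdegD dv mulnS addnC => /addnI.
Qed.

(** Induction on the number [r] of digits: the lowest digit gives the first factor, and the others
    belong to [m %/ p] with all Frobenius powers raised by one. The offset [j] absorbs this rise. *)
Lemma big_frob_mono_ideal d p r j m : p \in [pchar k] -> (m < p ^ r)%N ->
  \big[@ideal_mul _/setT]_(i < r)
     frob (mono_ideal [set u | mdeg u = (d * digit p m i)%N]) (p ^ (j + i)) =
  mono_ideal [set (g *+ p ^ j)%MM | g in frob_expo d p m].
Proof.
move=> pk; have p_gt0 : (0 < p)%N by rewrite prime_gt0 // (pcharf_prime pk).
elim: r j m => [|r IHr] j m ltm.
  move: ltm; rewrite ltnS leqn0 => /eqP ->; rewrite big_ord0 -mono_ideal_setT.
  congr mono_ideal; apply/seteqP; split=> [_ ->|_ [g mg <-]].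
    exists 0%MM; first exact: FrobExpo0.
    by apply/mnmP => i; rewrite mulmnE mnm0E.
  have /eqP := mdeg_frob_expo mg; rewrite muln0 mdeg_eq0 => /eqP ->.
  by apply/mnmP => i; rewrite mulmnE mnm0E.
rewrite big_ord_recl /= addn0.
have -> : \big[@ideal_mul _/setT]_(i < r)
     frob (mono_ideal [set u | mdeg u = (d * digit p m (bump 0 i))%N])
       (p ^ (j + bump 0 i)) =
     mono_ideal [set (g *+ p ^ j.+1)%MM | g in frob_expo d p (m %/ p)].
  rewrite -IHr; last by rewrite ltn_divLR // -expnSr.
  apply: eq_bigr => i _; rewrite /bump /= add1n addnS addSn.
  by rewrite /digit expnS divnMA.
rewrite frob_mono_ideal // mono_ideal_mul; congr mono_ideal.
rewrite /digit divn1; apply/seteqP; split.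
  move=> _ [_ [u /= du <-] [_ [g mg <-] <-]].
  exists (u + g *+ p)%MM.
    by rewrite /mkset [X in frob_expo _ _ X](divn_eq m p); apply: FrobExpoS;
       rewrite ?ltn_mod.
  by apply/mnmP => i; rewrite !(mnmDE, mulmnE) mulnDl expnS mulnA.
move=> _ [g mg <-]; have [u [g' [du mg' ->]]] := frob_expo_inv p_gt0 mg.
exists (u *+ p ^ j)%MM; first by exists u.
exists (g' *+ p ^ j.+1)%MM; first by exists g'.
by apply/mnmP => i; rewrite !(mnmDE, mulmnE) mulnDl expnS mulnA.
Qed.

End MonomialIdeals.
Arguments mono_ideal {n} k S.

Lemma max_ideal_mono (K : fieldType) n :
  @max_ideal K n = mono_ideal K [set m | mdeg m = 1%N].
Proof.
congr ideal_gen; apply/seteqP; split=> [_ [i _ <-]|].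
  by exists U_(i)%MM => //; apply: mdeg1.
by move=> _ [m /eqP/mdeg1P[i /eqP ->] <-]; exists i.
Qed.

Lemma frob_pow_nat_mono (K : fieldType) n d p m : p \in [pchar K] ->
  frob_pow_nat p (ideal_exp (@max_ideal K n) d) m =
  mono_ideal K (frob_expo d p m).
Proof.
move=> pK; have p_gt1 := prime_gt1 (pcharf_prime pK).
rewrite max_ideal_mono mono_ideal_exp mul1n /frob_pow_nat.
transitivity (mono_ideal K [set (g *+ p ^ 0)%MM | g in @frob_expo n d p m]).
  rewrite -(big_frob_mono_ideal _ _ _ pK (trunc_log_ltn m p_gt1)).
  by apply: eq_bigr => i _; rewrite mono_ideal_exp.
congr mono_ideal; apply/seteqP; split=> [_ [g mg <-] //|g mg].
by exists g.
Qed.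

(** * Powers of the generic form *)

(** When all exponents of [g] are below [q], an exponent of the form [m *+ q + delta] can only occur
    for [m = 0], so the coordinate is constant. *)
Lemma mroot_small n (k : comNzRingType) q (phi : k -> k)
    (delta : 'X_{1..n}) (g : {mpoly k[n]}) :
  (0 < q)%N -> phi 0 = 0 -> (forall i, delta i < q)%N ->
  (forall m, g@_m != 0 -> forall i, (m i < q)%N) ->
  mroot q phi delta g = (phi g@_delta)%:MP.
Proof.
move=> q_gt0 phi0 ltdq ltgq; apply/mpolyP => m; rewrite mcoeff_mroot // mcoeffC.
have [->|m0] := eqVneq m 0%MM.
  rewrite mulr1; congr (phi g@_ _); apply/mnmP => i.
  by rewrite mnmDE mulmnE mnm0E.
rewrite mulr0; suff -> : g@_(m *+ q + delta)%MM = 0 by [].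
apply/eqP; apply: contraNT m0 => /ltgq lt_q; apply/eqP/mnmP => i.
have := lt_q i; rewrite mnmDE mulmnE mnm0E; case: (m i) => // j.
by rewrite mulSn -addnA ltnNge leq_addr.
Qed.

(** * Multinomial coefficients modulo [p] *)

Section Multinomial.
Variables (l p : nat).
Hypothesis p_prime : prime p.
Let p_gt0 : (0 < p)%N := prime_gt0 p_prime.

(** The coefficients of its powers are the multinomial coefficients modulo [p]. *)
Definition sumX : {mpoly 'F_p[l]} := \sum_(i < l) 'X_i.

(** By Fermat's little theorem each element of ['F_p] is its own [p]-th root. *)
Lemma root_linear_Fp e : root_linear (p ^ e) (@id 'F_p).
Proof.
split=> // a b; congr (_ * b); elim: e => [|e IHe] //.
by rewrite expnSr exprM IHe -[in X in _ ^+ X](card_Fp p_prime) expf_card.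
Qed.

Lemma mderiv_sumX i m : (sumX ^+ m.+1)^`M(i) = sumX ^+ m *+ m.+1.
Proof.
have d1 : sumX^`M(i) = 1.
  rewrite /sumX raddf_sum (bigD1 i) //= big1 => [|j ji].
    rewrite mderivX mnm1E eqxx scale1r addr0 -mpolyX0; congr 'X_[_].
    by apply/mnmP => j; rewrite mnmBE subnn mnm0E.
  by rewrite mderivX mnm1E (negbTE ji) scale0r.
elim: m => [|m IHm]; first by rewrite expr1 expr0 d1.
by rewrite exprS mderivM d1 mul1r IHm mulrnAr -exprS [RHS]mulrS.
Qed.

Lemma dhomog_sumX m : sumX ^+ m \is m.-homog.
Proof.
rewrite -[X in X.-homog]mul1n dhomogMn //.
by apply: rpred_sum => i _; rewrite dhomogX; apply/eqP; apply: mdeg1.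
Qed.

Lemma mdeg_sumX m b : (sumX ^+ m)@_b != 0 -> mdeg b = m.
Proof. by rewrite -mcoeff_msupp => /(dhomog_mf (dhomog_sumX m)). Qed.

Lemma leq_sumX m b : (sumX ^+ m)@_b != 0 -> forall i, (b i <= m)%N.
Proof.
by move=> /mdeg_sumX <- i; rewrite mdegE (bigD1 i) //= leq_addr.
Qed.

(** Comparing coefficients in the derivative of the power, [b i] times the coefficient at [b] is [r]
    times the one at [b - U_(i)] in the previous power; [r] is invertible modulo [p] when
    [0 < r < p]. *)
Lemma mcoeff_sumX_neq0 r b : (r < p)%N -> mdeg b = r -> (sumX ^+ r)@_b != 0.
Proof.
elim: r b => [|r IHr] b ltrp degb.
  have /eqP := degb; rewrite mdeg_eq0 => /eqP ->.
  by rewrite mcoeff1 eqxx oner_eq0.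
have /existsP[i bi] : [exists i, b i != 0%N].
  apply: contra_eqT degb => /existsPn b0; rewrite mdegE big1 // => i _.
  by apply/eqP; rewrite -[_ == _]negbK.
have le_ib : (U_(i) <= b)%MM by rewrite lep1mP.
have degb' : mdeg (b - U_(i)) = r.
  by apply: succn_inj; rewrite -degb -[in RHS](submK le_ib) mdegD mdeg1 addn1.
have /(congr1 (mcoeff (b - U_(i))%MM)) := mderiv_sumX i r.
rewrite mcoeff_deriv (submK le_ib) mcoeffMn.
apply: contra_eqN => /eqP ->; rewrite mul0rn eq_sym -mulr_natr mulf_eq0.
rewrite (negbTE (IHr _ (ltnW ltrp) degb')) -(dvdn_pcharf (pchar_Fp p_prime)).
by apply/negP => /(dvdn_leq (ltn0Sn r)); rewrite leqNgt ltrp.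
Qed.

(** One digit of Lucas' theorem for multinomials: in [(sumX ^+ m) ^+ p * sumX ^+ r] the second
    factor has exponents below [p], so its coordinate along ['X_[b]] over [p]-th powers is a
    constant. *)
Lemma mcoeff_sumX_digit m r b b' : (r < p)%N -> mdeg b = r ->
  (sumX ^+ (m * p + r))@_(b + b' *+ p)%MM = (sumX ^+ m)@_b' * (sumX ^+ r)@_b.
Proof.
move=> ltrp degb.
have ltbp i : (b i < p)%N.
  by apply: leq_ltn_trans ltrp; rewrite -degb mdegE (bigD1 i) //= leq_addr.
have idL : root_linear p (@id 'F_p) by rewrite -[p in root_linear p]expn1;
  apply: root_linear_Fp.
rewrite addmC -(mcoeff_mroot _ (phi := id)) // exprD exprM.
have [_ ->] := root_linear_mroot (pchar_Fp p_prime) (pnat_id p_prime) ltbp idL.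
rewrite mroot_small //; first by rewrite mulrC mul_mpolyC mcoeffZ mulrC.
by move=> m' m'0 i; apply: leq_ltn_trans (leq_sumX m'0 i) ltrp.
Qed.

Variables (n d : nat) (a : l.-tuple 'X_{1..n}).
Hypothesis a_deg : forall m : 'X_{1..n}, (m \in a) = (mdeg m == d).

(** The exponent in the variables [x] of the image of ['X_[b]] when the [i]-th variable goes to
    [alpha i *: 'X_[tnth a i]]. *)
Definition mnm_dot (b : 'X_{1..l}) : 'X_{1..n} := (\sum_i tnth a i *+ b i)%MM.

Lemma mnm_dotD b b' : mnm_dot (b + b') = (mnm_dot b + mnm_dot b')%MM.
Proof.
apply/mnmP => j; rewrite mnmDE !mnm_sumE -big_split; apply: eq_bigr => i _.
by rewrite !(mulmnE, mnmDE) mulnDr.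
Qed.

Lemma mnm_dotMn b c : mnm_dot (b *+ c) = (mnm_dot b *+ c)%MM.
Proof.
apply/mnmP => j; rewrite mulmnE !mnm_sumE big_distrl; apply: eq_bigr => i _.
by rewrite !mulmnE mulnA.
Qed.

Lemma mnm_dot1 i : mnm_dot U_(i) = tnth a i.
Proof.
rewrite /mnm_dot (bigD1 i) //= mnm1E eqxx mulm1n big1 ?addm0 // => j ji.
by rewrite mnm1E eq_sym (negbTE ji).
Qed.

Lemma mnm_dot0 : mnm_dot 0 = 0%MM.
Proof. by rewrite /mnm_dot big1 // => i _; rewrite mnm0E. Qed.

(** Monomials of degree [d] are peeled off one at a time; each is an entry of [a], since [a] lists
    all of them. *)
Lemma mnm_dot_onto r (u : 'X_{1..n}) : mdeg u = (d * r)%N ->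
  exists2 b, mdeg b = r & mnm_dot b = u.
Proof.
elim: r u => [|r IHr] u.
  rewrite muln0 => /eqP; rewrite mdeg_eq0 => /eqP ->.
  by exists 0%MM; rewrite ?mdeg0 ?mnm_dot0.
move=> degu; have [v le_vu /eqP] : exists2 v, (v <= u)%MM & mdeg v = d.
  by apply: lem_mdeg_split; rewrite degu mulnS leq_addr.
rewrite -a_deg => va; have /tnthP[i vE] := va.
have [b degb bE] : exists2 b, mdeg b = r & mnm_dot b = (u - v)%MM.
  apply: IHr; apply/eqP; rewrite -(eqn_add2r (mdeg v)) -mdegD submK // degu.
  by move: va; rewrite a_deg => /eqP ->; rewrite mulnS addnC.
exists (b + U_(i))%MM; first by rewrite mdegD mdeg1 degb addn1.
by rewrite mnm_dotD mnm_dot1 bE -vE submK.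
Qed.

(** The exponent [b] is assembled digit by digit; its coefficient is a product of multinomials with
    top entries below [p], hence nonzero. *)
Lemma frob_expo_sumX m g : frob_expo d p m g ->
  exists2 b, (sumX ^+ m)@_b != 0 & mnm_dot b = g.
Proof.
elim=> [|{m g} m r u g ltrp degu _ [b' b'0 b'E]].
  by exists 0%MM; rewrite ?mnm_dot0 // expr0 mcoeff1 eqxx oner_eq0.
have [b degb bE] := mnm_dot_onto degu.
exists (b + b' *+ p)%MM; last by rewrite mnm_dotD mnm_dotMn bE b'E.
rewrite mcoeff_sumX_digit //; apply: mulf_neq0 => //.
exact: mcoeff_sumX_neq0.
Qed.

End Multinomial.

(** * Frobenius roots generated by monomials *)

Section FrobRootMono.
Variables (K : fieldType) (n d p : nat).
Hypothesis pK : p \in [pchar K].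
Let p_prime : prime p := pcharf_prime pK.
Let p_gt0 : (0 < p)%N := prime_gt0 p_prime.
Implicit Types (g : 'X_{1..n}).

Let modm g q := [multinom (g i %% q)%N | i < n].
Let divm g q := [multinom (g i %/ q)%N | i < n].

Let divm_eq g q : g = (divm g q *+ q + modm g q)%MM.
Proof. by apply/mnmP => i; rewrite !(mnmDE, mulmnE, mnmE) -divn_eq. Qed.

Lemma sub_frob_root_expo m e :
  mono_ideal K (@frob_expo n d p m) `<=`
  frob (mono_ideal K (root_expo d p m e)) (p ^ e).
Proof.
apply: ideal_gen_sub; first exact: is_ideal_gen.
move=> _ [g mg <-]; rewrite (divm_eq g (p ^ e)) mpolyXD mulrC -mpolyXn.
apply: ideal_genM; apply: sub_ideal_gen; exists 'X_[divm g (p ^ e)] => //.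
apply: sub_ideal_gen; exists (divm g (p ^ e)) => //.
by exists g => // i; rewrite mnmE.
Qed.

(** Common lower bound for powers of the maximal ideal and of the generic form. The condition says
    that [phi], applied to the coefficients of [h], isolates ['X_[g]] with a unit [c]; the matching
    coordinate of [h] is then [c] times the monomial of the floor of [g / p ^ e]. *)
Lemma root_expo_sub (J I : set {mpoly K[n]}) m e : is_ideal J ->
  I `<=` frob J (p ^ e) ->
  (forall g, frob_expo d p m g -> exists (phi : K -> K) h (c : K),
    [/\ root_linear (p ^ e) phi, I h, c != 0 & forall u (delta : 'X_{1..n}),
        (forall i, delta i < p ^ e)%N ->
        phi h@_(u *+ (p ^ e) + delta)%MM =
        c * (g == u *+ (p ^ e) + delta)%MM%:R]) ->
  [set 'X_[u] | u in root_expo d p m e] `<=` J.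
Proof.
move=> Jid IJ phiP _ [u [g mg le_gu] <-]; have [_ _ JM] := Jid.
have q_gt0 : (0 < p ^ e)%N by rewrite expn_gt0 p_gt0.
have -> : u = (u - divm g (p ^ e) + divm g (p ^ e))%MM.
  by rewrite submK //; apply/mnm_lepP => i; rewrite mnmE.
rewrite mpolyXD; apply: (JM); have [phi [h [c [phiL Ih c0 phiE]]]] := phiP _ mg.
have ltmod i : (modm g (p ^ e) i < p ^ e)%N by rewrite mnmE ltn_mod.
have pq : p.-nat (p ^ e)%N by rewrite pnatX pnat_id.
have rootL := root_linear_mroot pK pq ltmod phiL.
have /(_ _ (IJ _ Ih)) := root_linear_frob rootL Jid.
rewrite /= => /(JM (c^-1)%:MP); congr J; apply/mpolyP => v.
rewrite mul_mpolyC mcoeffZ mcoeff_mroot ?(root_linear0 phiL) // phiE //.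
rewrite mulKf // mcoeffX {1}(divm_eq g (p ^ e)) eqm_add2r; congr (_%:R).
apply: congr1; apply/eqP/eqP => [/mnmP eqv|->] //; apply/mnmP => i.
by have /eqP := eqv i; rewrite !mulmnE eqn_pmul2r // => /eqP.
Qed.

Lemma frob_pow_rat_mono m e (phi : K -> K) :
  root_linear (p ^ e) phi -> phi 1 = 1 ->
  frob_pow_rat p (ideal_exp (@max_ideal K n) d) m e =
  mono_ideal K (root_expo d p m e).
Proof.
move=> phiL phi1; rewrite /frob_pow_rat frob_pow_nat_mono //.
apply: frob_root_gen => [|J Jid].
  by move=> x Ex; apply: sub_frob_root_expo; apply: sub_ideal_gen.
move=> EJ; apply: root_expo_sub Jid EJ _ => g mg.
exists phi, 'X_[g], 1; split=> // [||u delta _]; first by exists g.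
  exact: oner_neq0.
by rewrite mcoeffX mul1r; case: (g == _); rewrite ?phi1 ?(root_linear0 phiL).
Qed.

End FrobRootMono.

(** * The generic form and its coefficient field *)

Section GenericForm.
Variables (n d p : nat) (l : nat) (a : l.-tuple 'X_{1..n}).
Hypothesis p_prime : prime p.
Hypothesis a_deg : forall m : 'X_{1..n}, (m \in a) = (mdeg m == d).
Variables (K : fieldType) (iota : {rmorphism 'F_p -> K}) (alpha : 'I_l -> K).
Hypothesis alpha_indep : alg_independent iota alpha.
Hypothesis alpha_gen : field_generated iota alpha.

Let f : {mpoly K[n]} := \sum_(i < l) alpha i *: 'X_[tnth a i].

Lemma pchar_generic : p \in [pchar K].
Proof. exact: (rmorph_pchar iota (pchar_Fp p_prime)). Qed.

Let pK := pchar_generic.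

(** Reads off the coordinate along the monomial [b] in the [alpha i] over [p ^ e]-th powers: defined
    on polynomials over ['F_p], then extended to [K], which independence and generation make their
    fraction field. *)
Lemma root_linear_generic e (b : 'X_{1..l}) : (forall i, b i < p ^ e)%N ->
  exists psi : K -> K, root_linear (p ^ e) psi /\
    forall P, psi (mmap iota alpha P) = mmap iota alpha (mroot (p ^ e) id b P).
Proof.
move=> ltb; have p_gt0 := prime_gt0 p_prime.
apply: root_linear_frac alpha_gen _; first by rewrite expn_gt0 p_gt0.
  apply: raddf_inj => P; exact: alpha_indep.
apply: root_linear_mroot (pchar_Fp p_prime) _ ltb (root_linear_Fp p_prime e).
by rewrite pnatX pnat_id.
Qed.

Lemma root_linear_generic1 e :
  exists psi : K -> K, root_linear (p ^ e) psi /\ psi 1 = 1.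
Proof.
have q_gt0 : (0 < p ^ e)%N by rewrite expn_gt0 prime_gt0.
have lt0 (i : 'I_l) : (0%MM i < p ^ e)%N by rewrite mnm0E.
have [psi [psiL psiE]] := root_linear_generic lt0.
exists psi; split=> //; have := psiE 1; rewrite rmorph1 => ->.
rewrite mroot_small //; first by rewrite mcoeff1 eqxx rmorph1.
move=> m; rewrite mcoeff1.
by have [-> _ i|] := eqVneq m 0%MM; rewrite ?mnm0E ?eqxx.
Qed.

(** Different [b] may give the same [v]; keeping the coefficient as the value of a polynomial at
    [alpha] lets the root-linear maps on [K] separate them. *)
Lemma mcoeff_generic_exp m v : (f ^+ m)@_v =
  mmap iota alpha (\sum_(b <- msupp (sumX l p ^+ m) | mnm_dot a b == v)
                     (sumX l p ^+ m)@_b *: 'X_[b]).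
Proof.
pose ev := mmap (@mpolyC n K \o iota) (fun i => alpha i *: 'X_[tnth a i]).
have -> : f = ev (sumX l p).
  rewrite /ev /sumX raddf_sum; apply: eq_bigr => i _.
  by rewrite /= mmapX mmap1U.
rewrite /ev -rmorphXn /= {1}/mmap !raddf_sum /= [RHS]big_mkcond /=.
apply: eq_bigr => b _; rewrite mul_mpolyC mcoeffZ.
have -> : mmap1 (fun i => alpha i *: 'X_[tnth a i]) b =
    mmap1 alpha b *: 'X_[mnm_dot a b] :> {mpoly K[n]}.
  rewrite /mmap1 /mnm_dot (big_morph _ (@mpolyXD n K) (mpolyX0 n K)).
  rewrite -scaler_prod; apply: eq_bigr => i _.
  by rewrite exprZn mpolyXn.
rewrite mcoeffZ mcoeffX; case: eqP => _; rewrite ?mulr0 //.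
by rewrite mmapZ mmapX mulr1.
Qed.

(** Strong induction along base [p] digits: [f ^+ m] is [f ^+ (m %% p)] times the [p]-th power of
    [f ^+ (m %/ p)]. *)
Lemma generic_exp_mem m : mono_ideal K (frob_expo d p m) (f ^+ m).
Proof.
have p_gt0 := prime_gt0 p_prime; have p_gt1 := prime_gt1 p_prime.
have f1 : mono_ideal K [set u : 'X_{1..n} | mdeg u = d] f.
  rewrite /mono_ideal; set U := ideal_gen _.
  set S := [set 'X_[_] | _ in _] in U *.
  have [U0 UD UM] : is_ideal U := is_ideal_gen S.
  apply: big_ind => // i _; rewrite -mul_mpolyC; apply: UM.
  apply: sub_ideal_gen; exists (tnth a i) => //.
  by apply/eqP; rewrite -a_deg mem_tnth.
have fr r : mono_ideal K [set u : 'X_{1..n} | mdeg u = (d * r)%N] (f ^+ r).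
  rewrite -mono_ideal_exp; elim: r => [|r IHr] //.
  by rewrite exprS /ideal_exp iterS; apply: sub_ideal_gen; exists f, (f ^+ r).
have [k] := ubnP m; elim: k m => // k IHk [|m] ltmk.
  rewrite expr0 -mpolyX0; apply: sub_ideal_gen.
  by exists 0%MM => //; apply: FrobExpo0.
rewrite [X in _ ^+ X](divn_eq _ p) addnC exprD exprM.
have lt_div : (m.+1 %/ p < k)%N by rewrite (leq_trans (ltn_Pdiv _ _)).
have : ideal_mul
    (mono_ideal K [set u : 'X_{1..n} | mdeg u = (d * (m.+1 %% p))%N])
    (frob (mono_ideal K (frob_expo d p (m.+1 %/ p))) (p ^ 1))
    (f ^+ (m.+1 %% p) * (f ^+ (m.+1 %/ p)) ^+ p).
  apply: sub_ideal_gen; exists (f ^+ (m.+1 %% p)), ((f ^+ (m.+1 %/ p)) ^+ p).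
  split=> //; apply: sub_ideal_gen; exists (f ^+ (m.+1 %/ p)) => //.
  exact: IHk.
rewrite frob_mono_ideal // mono_ideal_mul; apply: ideal_gen_mono.
move=> _ [_ [u /= du [_ [g mg <-] <-]] <-].
apply: sub_ideal_gen; exists (u + g *+ p ^ 1)%MM => //=.
by rewrite [X in frob_expo _ _ X](divn_eq _ p); apply: FrobExpoS;
   rewrite ?ltn_mod.
Qed.

Lemma frob_root_generic m e : (m < p ^ e)%N ->
  frob_root (ideal_exp (ideal_gen [set f]) m) (p ^ e) =
  mono_ideal K (root_expo d p m e).
Proof.
move=> ltm; have q_gt0 : (0 < p ^ e)%N by rewrite expn_gt0 prime_gt0.
rewrite ideal_exp_principal; apply: frob_root_gen => [_ ->|J Jid fJ].
  by apply: sub_frob_root_expo; apply: generic_exp_mem.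
apply: root_expo_sub Jid fJ _ => // g mg.
have [b b0 bE] := frob_expo_sumX p_prime a_deg mg.
(* This is where [m < p ^ e] enters: all monomials in [alpha] occurring in [f ^+ m] are distinct
   basis members, so the coordinate along [b] kills the others. *)
have ltbq i : (b i < p ^ e)%N by apply: leq_ltn_trans (leq_sumX b0 i) ltm.
have [psi [psiL psiE]] := root_linear_generic ltbq.
exists psi, (f ^+ m), (iota (sumX l p ^+ m)@_b); split=> //.
  by rewrite fmorph_eq0.
move=> u delta _; rewrite mcoeff_generic_exp psiE.
set v := (u *+ _ + _)%MM; set P := \sum_(_ <- _ | _) _.
have PE b' : P@_b' = (sumX l p ^+ m)@_b' * (mnm_dot a b' == v)%:R.
  rewrite {1}[sumX l p ^+ m]mpolyE !raddf_sum /= mulr_suml big_mkcond /=.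
  apply: eq_bigr => b2 _; rewrite mcoeffZ mcoeffX.
  by case: (eqVneq b2 b') => [->|_]; case: ifP => _;
    rewrite ?mcoeff0 ?mcoeffZ ?mcoeffX ?eqxx ?(mulr0, mulr1, mul0r).
rewrite mroot_small //; first rewrite mmapC PE bE.
  by case: (g == v); rewrite ?mulr1 ?mulr0 ?raddf0.
move=> b'; rewrite PE mulf_eq0 negb_or => /andP[b'0 _] i.
exact: leq_ltn_trans (leq_sumX b'0 i) ltm.
Qed.

End GenericForm.

(** * Passage to real exponents *)

Lemma absz_ceil_le (R : realType) (x : R) (m : nat) : 0 <= x ->
  (`|Num.ceil x| <= m)%N = (x <= m%:R).
Proof.
move=> x0; rewrite -lez_nat gez0_abs ?ceil_le_int ?pmulrn //.
by rewrite ceil_ge0 (lt_le_trans _ x0) ?ltrN10.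
Qed.

Theorem theorem2 (n d p : nat) (n_ge1 : (1 <= n)%N) (d_ge1 : (1 <= d)%N)
  (p_prime : prime p)
  (l : nat) (a : l.-tuple 'X_{1..n})
  (a_distinct : uniq a)
  (a_deg : forall m : 'X_{1..n}, (m \in a) = (mdeg m == d))
  (K : fieldType) (iota : {rmorphism 'F_p -> K}) (alpha : 'I_l -> K)
  (alpha_indep : alg_independent iota alpha)
  (alpha_gen : field_generated iota alpha)
  (d_lt_p : (d < p)%N)
  (R : realType) (t : R) (t_gt0 : 0 < t) (t_lt1 : t < 1) :
  let f : {mpoly K[n]} := \sum_(i < l) alpha i *: 'X_[tnth a i] in
  exists J : set {mpoly K[n]},
    is_test_ideal p (ideal_gen [set f]) t J /\
    is_frob_pow p (ideal_exp (@max_ideal K n) d) t J.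
Proof.
move=> f; have p_gt0 := prime_gt0 p_prime; have p_gt1 := prime_gt1 p_prime.
have pR e : 0 < p%:R ^+ e :> R by rewrite exprn_gt0 // ltr0n.
pose c e := `|Num.ceil (t * p%:R ^+ e)|%N.
have cP e m : (c e <= m)%N = (t * p%:R ^+ e <= m%:R).
  by rewrite absz_ceil_le // ltW // mulr_gt0.
have c_ge e : t * p%:R ^+ e <= (c e)%:R by rewrite -cP.
(* The fractions [c e / p ^ e] decrease towards [t], so the exponent sets grow with [e]. *)
have c_mono e e' : (e <= e')%N ->
    @root_expo n d p (c e) e `<=` root_expo d p (c e') e'.
  move=> /subnKC <-; apply: root_expo_mono => //.
  rewrite expnD [X in (_ <= X)%N]mulnCA [X in (X <= _)%N]mulnC leq_mul2l.
  apply/orP; right; rewrite cP exprD mulrA natrM natrX.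
  by rewrite ler_wpM2r // ltW.
(* For each of the finitely many exponents of degree at most [d], [E] picks a level at which it has
   entered the chain, if it ever does; from the maximum [N] on the chain is constant. *)
have /choice[E EP] (b : 'X_{1..n < d.+1}) : exists e,
    (exists e', root_expo d p (c e') e' b) -> root_expo d p (c e) e b.
  by have [[e' be']|nb] := pselect (exists e', root_expo d p (c e') e' b);
    [exists e'|exists 0%N].
pose N := (\max_b E b)%N; pose U := @root_expo n d p (c N) N.
have subU e : root_expo d p (c e) e `<=` U.
  move=> u ue; have le_cp : (c e <= p ^ e)%N.
    by rewrite cP natrX ger_pMl // ltW.
  have [v ve [degv le_vu]] := root_expo_bounded p_gt0 le_cp ue.
  apply: root_expo_up le_vu; have ltv : (mdeg v < d.+1)%N by [].
  apply: (c_mono (E (BMultinom ltv)) N); first exact: leq_bigmax.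
  by apply: EP; exists e.
exists (mono_ideal K U); split.
  (* The second bound gives [p ^ e * (1 - t) >= 1], hence [c e < p ^ e], as the root of a power of
     [f] requires. *)
  exists (maxn N `|Num.ceil (1 - t)^-1|) => // e /=.
  rewrite geq_max => /andP[leNe].
  have t1 : 0 < 1 - t by rewrite subr_gt0.
  have t1V : 0 <= (1 - t)^-1 by rewrite invr_ge0 ltW.
  rewrite absz_ceil_le // => le_e.
  have lt_cp : (c e < p ^ e)%N.
    rewrite -(ltn_predK (ltn_expl e p_gt1)) ltnS cP.
    rewrite -(lerD2r 1) natr1 (ltn_predK (ltn_expl e p_gt1)) natrX -lerBrDl.
    have : (1 - t)^-1 <= p%:R ^+ e.
      by rewrite (le_trans le_e) // -natrX ler_nat ltnW // ltn_expl.
    by rewrite -[_^-1]mul1r ler_pdivrMr // mulrBr mulr1 [_ * t]mulrC.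
  rewrite -/(c e).
  rewrite (frob_root_generic p_prime a_deg alpha_indep alpha_gen) //.
  congr mono_ideal.
  by apply/seteqP; split; [apply: subU|apply: c_mono].
move=> m e u u_dec u_t.
have ratE k : frob_pow_rat p (ideal_exp (@max_ideal K n) d) (m k) (e k) =
    mono_ideal K (root_expo d p (m k) (e k)).
  have [psi [psiL psi1]] :=
    root_linear_generic1 p_prime alpha_indep alpha_gen (e k).
  by apply: frob_pow_rat_mono psiL psi1; apply: (pchar_generic _ iota).
apply/seteqP; split; last first.
  (* A nonincreasing sequence stays above its limit, so [m k >= t * p ^ e k], and [m k >= c (e k)]
     by integrality. *)
  move=> x [k _]; rewrite ratE; apply: ideal_gen_mono => _ [v vk <-].
  apply: sub_ideal_gen; exists v => //; apply: (subU (e k)).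
  apply: root_expo_mono vk => //; rewrite leq_mul2r cP -ler_pdivlMr //.
  have := nonincreasing_cvgn_ge u_dec (cvgP _ u_t) k.
  by rewrite (cvg_lim _ u_t) // => ->; rewrite orbT.
(* Right constancy: [y] exceeds [c N / p ^ N] by [1 / p ^ N.+1], so it lies strictly above [t] even
   if [t] equals that fraction, yet no exponent of [U] is lost at [y]. Some [u k] falls below
   [y]. *)
pose y : R := (c N * p + 1)%:R / p%:R ^+ N.+1.
have lt_ty : t < y.
  rewrite ltr_pdivlMr // exprSr mulrA natrD natrM.
  by rewrite (le_lt_trans (ler_wpM2r _ (c_ge N))) // ltrDl ltr01.
have [k ltk] : exists k, u k < y.
  have nearlt : \forall k \near \oo, u k < y by apply: cvgr_lt lt_ty.
  exact: filter_ex nearlt.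
move=> x Jx; exists k => //; rewrite ratE; move: x Jx.
apply: ideal_gen_mono => _ [v vU <-]; apply: sub_ideal_gen; exists v => //.
apply: (root_expo_mono (m := (c N * p + 1)%N) (e := N.+1)) => //; last first.
  exact: root_expo_right.
rewrite -(ler_nat R) !natrM !natrX.
by move: (ltW ltk); rewrite /u /y ler_pdivrMr // mulrAC ler_pdivlMr.
Qed.
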